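(* Let $G$ be a finite group and $S\subseteq G$. If the Haar graph $H(G,S)$ is a Cayley graph, then there exist a group $\tilde G$ and a subset $\tilde S$ of $\tilde G$ such that $H(G,S)\cong H(\tilde G,\tilde S)$ and $H(\tilde G,\tilde S)$ is algebraically Cayley.
   Context: All groups and graphs are finite and graphs are undirected. For a group $G$ and an arbitrary subset $S\subseteq G$, the Haar graph $H(G,S)$ is the graph with vertex set $G\times\{0,1\}$ and edges $[(x,0),(sx,1)]$ for $x\in G$, $s\in S$. For a group $A$ and $T\subseteq A$ with $1_A\notin T$ and $T=T^{-1}$, the Cayley graph $\mathrm{Cay}(A,T)$ has vertex set $A$ and edges $[x,tx]$ for $x\in A$, $t\in T$. A graph $X$ is called a Cayley graph if it is isomorphic to some $\mathrm{Cay}(A,T)$ (equivalently, $\operatorname{Aut} X$ contains a subgroup acting regularly on the vertex set). For $g\in G$ let $g_R$ be the permutation of $G\times\{0,1\}$ given by $(x,i)^{g_R}=(xg,i)$, and let $G_R=\{g_R: g\in G\}\le \operatorname{Aut} H(G,S)$. The Haar graph $X=H(G,S)$ is called algebraically Cayley if there is a subgroup $A\le\operatorname{Aut} X$ with $G_R\le A$ such that $A$ acts regularly on the vertex set $V(X)$. *)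

(* Defs.v *)
From mathcomp Require Import all_boot all_fingroup.

Set Implicit Arguments.
Unset Strict Implicit.
Unset Printing Implicit Defensive.

Local Open Scope group_scope.

(* A graph on a finite vertex type V is given by its adjacency relation
   e : rel V; the lemmas haar_sym, haar_irr, cayley_sym and cayley_irr show
   that the graphs below are undirected and loopless. *)

Definition graph_iso (V W : finType) (e : rel V) (f : rel W) : Prop :=
  exists phi : V -> W, bijective phi /\ forall u v, f (phi u) (phi v) = e u v.

Definition graph_aut (V : finType) (e : rel V) : {set {perm V}} :=
  [set p : {perm V} | [forall u, forall v, e (p u) (p v) == e u v]].

Lemma graph_aut_group_set (V : finType) (e : rel V) : group_set (graph_aut e).
Proof.
apply/group_setP; split=> [|p q].
  by rewrite inE; apply/forallP=> u; apply/forallP=> v; rewrite !perm1.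
rewrite !inE => /forallP Hp /forallP Hq.
apply/forallP=> u; apply/forallP=> v; rewrite !permM.
by rewrite (eqP (forallP (Hq _) _)) (eqP (forallP (Hp _) _)).
Qed.

Canonical graph_aut_group (V : finType) (e : rel V) : {group {perm V}} :=
  Group (graph_aut_group_set e).

Definition regular_perm (V : finType) (A : {group {perm V}}) : bool :=
  [transitive A, on [set: V] | 'P] && [forall v : V, 'C_A[v | 'P] == 1].

Definition cayley_rel (aT : finGroupType) (T : {set aT}) : rel aT :=
  fun x y => [exists t in T, y == t * x].

Definition cayley_graph (V : finType) (e : rel V) : Prop :=
  exists (aT : finGroupType) (T : {set aT}),
    [/\ 1 \notin T, T = T^-1 & graph_iso e (cayley_rel T)].

(* The index set {0, 1} is bool, with false for 0 and true for 1. *)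
Definition haar_rel (gT : finGroupType) (S : {set gT}) : rel (gT * bool) :=
  fun u v => [exists x : gT, exists s in S,
    ((u == (x, false)) && (v == (s * x, true)))
    || ((v == (x, false)) && (u == (s * x, true)))].

Lemma haar_sym (gT : finGroupType) (S : {set gT}) : symmetric (haar_rel S).
Proof.
by move=> u v; apply: eq_existsb => x; apply: eq_existsb => s; rewrite /= orbC.
Qed.

Lemma haar_irr (gT : finGroupType) (S : {set gT}) : irreflexive (haar_rel S).
Proof.
move=> [x i]; apply/existsP=> -[y /exists_inP[s _]].
by rewrite orbb !xpair_eqE; case: i; rewrite !andbF.
Qed.

Lemma cayley_sym (aT : finGroupType) (T : {set aT}) :
  T = T^-1 -> symmetric (cayley_rel T).
Proof.
move=> TV x y; apply/exists_inP/exists_inP=> -[t Tt /eqP->];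
  by exists t^-1; rewrite ?mulKg // TV inE invgK.
Qed.

Lemma cayley_irr (aT : finGroupType) (T : {set aT}) :
  1 \notin T -> irreflexive (cayley_rel T).
Proof.
move=> T1 x; apply/exists_inP=> -[t Tt].
by rewrite -[X in X == _]mul1g => /eqP/mulIg t1; rewrite t1 Tt in T1.
Qed.

Lemma right_mul_inj (gT : finGroupType) (g : gT) :
  injective (fun u : gT * bool => (u.1 * g, u.2)).
Proof. by move=> [x i] [y j] [/mulIg-> ->]. Qed.

Definition right_mul (gT : finGroupType) (g : gT) : {perm gT * bool} :=
  perm (@right_mul_inj gT g).

Definition right_muls (gT : finGroupType) : {set {perm gT * bool}} :=
  [set right_mul g | g : gT].

Definition algebraically_cayley (gT : finGroupType) (S : {set gT}) : Prop :=
  exists A : {group {perm gT * bool}},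
    [/\ A \subset graph_aut (haar_rel S), right_muls gT \subset A
      & regular_perm A].

(* Main.v *)
Require Import Defs.
From mathcomp Require Import all_boot all_fingroup zmodp.

Set Implicit Arguments.
Unset Strict Implicit.
Unset Printing Implicit Defensive.

Local Open Scope group_scope.

(** Let the Haar graph X be isomorphic to Cay(A, T).  If A carries a parity,
    that is, a surjective homomorphism to Z/2, for which all of T is odd, then
    its kernel N acts by right translations with the two cosets of N as
    orbits.  Identifying both cosets with N turns Cay(A, T) into a Haar graph
    of N on which A still acts regularly, extending the right translations by
    N ([haar_of_parity]).

    The bipartition of X supplies such a parity when X is connected, but not
    in general: the side of a vertex may be flipped independently on each
    component.  What always works is to restrict to the subgroup Q of the
    elements h whose left translation either preserves the side of every
    vertex or reverses the side of every vertex.  Q contains T, and the side is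
    a parity on Q up to a constant.  Since T lies in Q, the right cosets of Q
    are unions of components, each inducing a copy of Cay(Q, T), so A may be
    replaced with the direct product of Q and any group of order |A : Q|, a
    cyclic one say ([cayley_splits]).  The parity of the first factor is then
    a parity on the product.

    It is surjective as soon as T is nonempty.  If T is empty, X has no edges
    and is the Cayley graph of the product of G and Z/2 for the empty set. *)

Lemma graph_iso_sym (V W : finType) (e : rel V) (f : rel W) :
  graph_iso e f -> graph_iso f e.
Proof.
move=> [phi [[psi phiK psiK] phi_e]]; exists psi; split; first by exists phi.
by move=> u v; rewrite -phi_e !psiK.
Qed.

Lemma graph_iso_trans (V W U : finType) (e : rel V) (f : rel W) (g : rel U) :
  graph_iso e f -> graph_iso f g -> graph_iso e g.
Proof.
move=> [phi [phi_bij phi_e]] [psi [psi_bij psi_e]].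
exists (psi \o phi); split; first exact: bij_comp.
by move=> u v; rewrite /= psi_e phi_e.
Qed.

Lemma haar_relE (gT : finGroupType) (S : {set gT}) (x y : gT) (i j : bool) :
  haar_rel S (x, i) (y, j) =
  (i != j) && (if j then y * x^-1 \in S else x * y^-1 \in S).
Proof.
apply/existsP/idP=> [[z /exists_inP[s Ss]]|].
  by case/orP=> /andP[/eqP[-> ->] /eqP[-> ->]]; rewrite mulgK.
case: i j => -[] //= Sxy.
  exists y; apply/exists_inP; exists (x * y^-1) => //.
  by rewrite mulgKV !eqxx orbT.
exists x; apply/exists_inP; exists (y * x^-1) => //.
by rewrite mulgKV !eqxx.
Qed.

Lemma haar_rel_sides (gT : finGroupType) (S : {set gT}) (u v : gT * bool) :
  haar_rel S u v -> v.2 = ~~ u.2.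
Proof. by case: u v => [x i] [y j]; rewrite haar_relE; case: i j => -[]. Qed.

Lemma cayley_relE (aT : finGroupType) (T : {set aT}) (x y : aT) :
  cayley_rel T x y = (y * x^-1 \in T).
Proof.
apply/exists_inP/idP=> [[t Tt /eqP->]|Tyx]; first by rewrite mulgK.
by exists (y * x^-1); rewrite ?mulgKV.
Qed.

(** * Groups with a parity *)

Section Parity.

Variables (bT : finGroupType) (eps : bT -> bool).
Hypothesis epsM : forall x y, eps (x * y) = eps x (+) eps y.

Lemma eps1 : eps 1 = false.
Proof. by have:= epsM 1 1; rewrite mulg1; case: (eps 1). Qed.

Lemma epsV x : eps x^-1 = eps x.
Proof. by have:= epsM x x^-1; rewrite mulgV eps1; case: (eps x); case: eps. Qed.

Lemma even_group_set : group_set [set x | ~~ eps x].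
Proof.
apply/group_setP; split=> [|x y]; first by rewrite inE eps1.
by rewrite !inE epsM => /negPf-> /negPf->.
Qed.
Definition even_group := Group even_group_set.

Lemma mem_even x : (x \in even_group) = ~~ eps x.
Proof. by rewrite inE. Qed.

Lemma eps_even (k : [subg even_group]) : eps (sgval k) = false.
Proof. by apply/negbTE; rewrite -mem_even; apply: subgP. Qed.

Variables (T : {set bT}) (t0 : bT).
Hypotheses (TV : T = T^-1) (odd_t0 : eps t0) (oddT : {in T, forall t, eps t}).

(** The odd coset is identified with the kernel by a left multiplication because
    this commutes with right translations: those by the kernel then become the
    right translations of the Haar graph. *)
Let glue (u : [subg even_group] * bool) : bT :=
  if u.2 then t0 * sgval u.1 else sgval u.1.

Let unglue (x : bT) : [subg even_group] * bool :=
  (subg even_group (if eps x then t0^-1 * x else x), eps x).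

Let glueK : cancel glue unglue.
Proof.
by move=> [k []]; rewrite /glue /unglue /= ?epsM eps_even ?odd_t0 /= ?mulKg sgvalK.
Qed.

Let unglueK : cancel unglue glue.
Proof.
move=> x; rewrite /glue /unglue /=.
by case eps_x: (eps x); rewrite subgK ?mulKVg // mem_even ?epsM ?epsV ?odd_t0 eps_x.
Qed.

Let connection : {set [subg even_group]} := [set s | t0 * sgval s \in T].

Let memTV x y : (x * y^-1 \in T) = (y * x^-1 \in T).
Proof. by rewrite [in LHS]TV inE invMg invgK. Qed.

Let glue_rel u v : cayley_rel T (glue u) (glue v) = haar_rel connection u v.
Proof.
case: u v => [k i] [l j]; rewrite cayley_relE haar_relE /glue /=.
(* Two vertices on the same side differ by an even element, so they are not
   adjacent. *)
have notT x : eps x = false -> (x \in T) = false.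
  by move=> ev; apply: contraFF ev => /oddT.
case: i j => -[] /=; rewrite ?inE.
- by rewrite notT // !(epsM, epsV) !eps_even odd_t0.
- by rewrite memTV mulgA.
- by rewrite mulgA.
- by rewrite notT // epsM epsV !eps_even.
Qed.

Let transl_inj g : injective (fun u => unglue (glue u * g)).
Proof. by move=> u v /(can_inj unglueK)/mulIg/(can_inj glueK). Qed.

Let transl g := perm (@transl_inj g).

Let translE g u : transl g u = unglue (glue u * g).
Proof. by rewrite permE. Qed.

Let transl_group_set : group_set [set transl g | g : bT].
Proof.
apply/group_setP; split=> [|_ _ /imsetP[g _ ->] /imsetP[h _ ->]].
  apply/imsetP; exists 1 => //; apply/permP=> u.
  by rewrite translE perm1 mulg1 glueK.
apply/imsetP; exists (g * h) => //; apply/permP=> u.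
by rewrite permM !translE unglueK mulgA.
Qed.

Let transl_aut : Group transl_group_set \subset graph_aut (haar_rel connection).
Proof.
apply/subsetP=> _ /imsetP[g _ ->]; rewrite inE.
apply/forallP=> u; apply/forallP=> v; rewrite !translE -!glue_rel !unglueK.
by rewrite !cayley_relE invMg mulgA mulgK.
Qed.

Let transl_right_muls : right_muls (subg_of even_group) \subset Group transl_group_set.
Proof.
apply/subsetP=> _ /imsetP[k _ ->]; apply/imsetP; exists (sgval k) => //.
apply/permP=> -[l i]; rewrite translE permE -[LHS]glueK /glue /=.
by case: i => //=; rewrite mulgA.
Qed.

Let transl_regular : regular_perm (Group transl_group_set).
Proof.
apply/andP; split.
  apply/imsetP; exists (1, false) => //; apply/esym/setP=> v; rewrite inE.
  apply/orbitP; exists (transl (glue v)); first exact: imset_f.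
  by rewrite /= apermE translE /glue /= mul1g glueK.
apply/forallP=> v; apply/eqP/trivgP/subsetP=> _ /setIP[/imsetP[g _ ->]].
move/astab1P; rewrite /= apermE translE => fix_v.
have ->: g = 1 by apply: (mulgI (glue v)); rewrite mulg1 -{2}fix_v unglueK.
by rewrite inE; apply/eqP/permP=> u; rewrite translE mulg1 glueK perm1.
Qed.

Lemma haar_of_parity : exists (hT : finGroupType) (S : {set hT}),
  graph_iso (cayley_rel T) (haar_rel S) /\ algebraically_cayley S.
Proof.
exists (subg_of even_group), connection; split.
  apply: graph_iso_sym; exists glue; split=> [|u v]; last exact: glue_rel.
  by exists unglue.
by exists (Group transl_group_set).
Qed.

End Parity.

(** * Cayley graphs with a connection set in a subgroup *)

(** The vertex (q, j) of the product corresponds to the product of q with a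
    representative of the j-th right coset of Q; edges multiply on the left by
    elements of T, so they only move q. *)
Lemma cayley_splits (aT : finGroupType) (T : {set aT}) (Q : {group aT}) :
  T \subset Q -> exists n,
  graph_iso (cayley_rel T)
    (cayley_rel (setX (sgval @^-1: T) 1 : {set [subg Q] * 'I_n.+1})).
Proof.
move=> sTQ; have index_gt0 := indexg_gt0 [set: aT] Q.
exists #|[set: aT] : Q|.-1.
pose coset_rep (j : 'I_#|[set: aT] : Q|.-1.+1) :=
  repr (enum_val (cast_ord (prednK index_gt0) j)).
have coset_repK j : Q :* coset_rep j = enum_val (cast_ord (prednK index_gt0) j).
  rewrite /coset_rep; move: (cast_ord _ j) => i.
  have /rcosetsP[x _ ->]: enum_val i \in rcosets Q [set: aT] by exact: enum_valP.
  exact: rcoset_repr.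
have coset_rep_inj (q r : [subg Q]) j k :
    sgval r * coset_rep k * (sgval q * coset_rep j)^-1 \in Q -> k = j.
  rewrite invMg mulgA groupMr ?groupV ?subgP // -mulgA groupMl ?subgP //.
  rewrite -mem_rcoset => /rcoset_eqP; rewrite !coset_repK.
  by move/enum_val_inj/cast_ord_inj.
apply: graph_iso_sym; exists (fun u => sgval u.1 * coset_rep u.2); split.
  apply: inj_card_bij => [[q j] [r k] /= eq_qr|].
    have eq_jk: j = k.
      by apply: (@coset_rep_inj r q); rewrite eq_qr mulgV group1.
    by move: eq_qr; rewrite eq_jk => /mulIg/val_inj->.
  rewrite card_prod card_ord prednK // -cardsT -(Lagrange (subsetT Q)).
  by rewrite (card_isog (isog_subg Q)) cardsT.
move=> [q j] [r k]; rewrite !cayley_relE !inE /= -eq_mulgV1.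
have [->|neq_kj] := eqVneq k j; first by rewrite invMg mulgA mulgK andbT.
(* Vertices in distinct right cosets of Q are not adjacent, as T lies in Q. *)
rewrite andbF; apply: contra_neqF neq_kj => /(subsetP sTQ) Qrq.
exact: coset_rep_inj Qrq.
Qed.

(** * Parity from a bipartition *)

Section Sides.

Variables (aT : finGroupType) (T : {set aT}) (side : aT -> bool).
Hypothesis sideT : forall t x, t \in T -> side (t * x) = ~~ side x.

Let side_change t : t \in T -> side t (+) side 1 = true.
Proof. by move=> Tt; have:= sideT 1 Tt; rewrite mulg1 => ->; case: side. Qed.

(** For h fixed, the equation says that left translation by h changes all sides
    or none: its value at x = 1 forces the common change to be
    side h (+) side 1.  Such h form a subgroup on which side h (+) side 1 is
    additive, whereas on the whole group the sides of distinct components are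
    unrelated. *)
Lemma uniform_group_set :
  group_set [set h | [forall x, side (h * x) == side h (+) side 1 (+) side x]].
Proof.
apply/group_setP; split=> [|h k].
  by rewrite inE; apply/forallP=> x; rewrite mul1g addbb.
rewrite !inE => /forallP Hh /forallP Hk; apply/forallP=> x.
by rewrite -mulgA !(eqP (Hh _)) !(eqP (Hk _)) !addbA.
Qed.
Definition uniform_group := Group uniform_group_set.

Lemma sub_uniform : T \subset uniform_group.
Proof.
apply/subsetP=> t Tt; rewrite inE; apply/forallP=> x.
by rewrite sideT // side_change // addTb.
Qed.

Lemma haar_of_sides t0 : t0 \in T -> T = T^-1 ->
  exists (hT : finGroupType) (S : {set hT}),
    graph_iso (cayley_rel T) (haar_rel S) /\ algebraically_cayley S.
Proof.
move=> Tt0 TV; have [n isoT] := cayley_splits sub_uniform.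
pose eps (u : [subg uniform_group] * 'I_n.+1) := side (sgval u.1) (+) side 1.
have epsM u v : eps (u * v) = eps u (+) eps v.
  rewrite /eps /=; have:= subgP u.1; rewrite inE => /forallP/(_ (sgval v.1)).
  by move/eqP->; rewrite !addbA.
have Qt0 := subsetP sub_uniform _ Tt0.
have [] := @haar_of_parity _ eps epsM
  (setX (sgval @^-1: T) 1) (subg uniform_group t0, 1).
- by apply/setP=> -[q j]; rewrite !inE /= eq_invg1 [in LHS]TV inE.
- by rewrite /eps /= subgK // side_change.
- by move=> [q j] /setXP[]; rewrite inE => /side_change.
move=> hT [S [isoS algS]]; exists hT, S; split=> //.
exact: graph_iso_trans isoT isoS.
Qed.

End Sides.

(** * Haar graphs without edges *)

Lemma haar_of_edgeless (gT : finGroupType) (S : {set gT}) :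
  (forall u v, haar_rel S u v = false) ->
  exists (hT : finGroupType) (S' : {set hT}),
    graph_iso (haar_rel S) (haar_rel S') /\ algebraically_cayley S'.
Proof.
move=> noE.
pose eps (u : gT * 'I_2) := odd u.2.
have epsM u v : eps (u * v) = eps u (+) eps v.
  by case: u v => [x [[|[]] ? //]] [y [[|[]] ? //]].
have [] := @haar_of_parity _ eps epsM set0 (1, inord 1).
- by apply/setP=> u; rewrite !inE.
- by rewrite /eps /= inordK.
- by move=> t; rewrite inE.
move=> hT [S' [isoS' algS']]; exists hT, S'; split=> //.
apply: graph_iso_trans isoS'.
exists (fun u : gT * bool => (u.1, inord u.2 : 'I_2)); split.
  exists (fun u => (u.1, eps u)) => [[x i]|[x i]] /=.
    by rewrite /eps /= inordK; case: i.
  congr (_, _); apply: val_inj; rewrite /eps /= inordK.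
    by case: i => [[|[]]].
  by case: (odd i).
by move=> u v; rewrite noE cayley_relE inE.
Qed.

Theorem corollary6 (gT : finGroupType) (S : {set gT}) :
  cayley_graph (haar_rel S) ->
  exists (hT : finGroupType) (S' : {set hT}),
    graph_iso (haar_rel S) (haar_rel S') /\ algebraically_cayley S'.
Proof.
move=> [aT [T [_ TV isoT]]].
have [phi [[psi phiK psiK] phi_e]] := isoT.
have [T0|[t0 Tt0]] := set_0Vmem T.
  by apply: haar_of_edgeless => u v; rewrite -phi_e T0 cayley_relE inE.
have sideT t x : t \in T -> (psi (t * x)).2 = ~~ (psi x).2.
  move=> Tt; apply: (@haar_rel_sides _ S).
  by rewrite -phi_e !psiK cayley_relE mulgK.
have [hT [S' [isoS' algS']]] := haar_of_sides sideT Tt0 TV.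
by exists hT, S'; split=> //; apply: graph_iso_trans isoS'.
Qed.
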